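(* Let $f:\mathbb{R}^d\to\mathbb{R}$ be quasiconvex and locally Lipschitz (not necessarily bounded from below), let $\varepsilon>0$, and let $$f_\varepsilon(x)=\inf_{w\in\mathbb{B}} f(x-\varepsilon w),\qquad x\in\mathbb{R}^d,$$ where $\mathbb{B}$ is the closed unit ball. Set $$\mathcal{U}_\varepsilon=\{x\in\mathbb{R}^d:\ \overline{|\nabla f|}\big(\operatorname{proj}(x;[f\le f_\varepsilon(x)])\big)>0\}.$$ Then $f_\varepsilon$ admits steepest descent curves emanating from (Lebesgue) almost every $x\in\mathcal{U}_\varepsilon$. In particular, if for every $x\in\operatorname{dom} f\setminus\operatorname{argmin} f$ there exist $\delta,\ell>0$ such that $|\nabla f|(y)>\ell$ for all $y\in B(x,\delta)\cap\operatorname{dom} f$, then $f_\varepsilon$ admits steepest descent curves emanating from almost every $x\in\operatorname{dom} f_\varepsilon$.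
   Context: $\mathbb{R}^d$ carries the Euclidean norm; $B(x,\delta)$ is the open ball; $\operatorname{dom} f=\{x: f(x)<+\infty\}$; $[f\le\alpha]=\{x: f(x)\le\alpha\}$; $\operatorname{proj}(x;S)$ is the nearest point of $x$ in the closed convex set $S$. $f$ is quasiconvex if $f(tx+(1-t)y)\le\max\{f(x),f(y)\}$ for all $x,y\in\mathbb{R}^d$, $t\in[0,1]$. Metric slope of a function $g:\mathbb{R}^d\to\mathbb{R}\cup\{+\infty\}$: $|\nabla g|(x)=\limsup_{y\to x}\frac{(g(x)-g(y))^+}{\|x-y\|}$ if $x\in\operatorname{dom} g$, and $+\infty$ otherwise, where $a^+=\max\{a,0\}$. Limiting slope: $\overline{|\nabla g|}(x)=\liminf_{y\to_g x}|\nabla g|(y)$, where $y\to_g x$ means $(y,g(y))\to(x,g(x))$. A steepest descent curve of $g$ emanating from $x_0$ is a $1$-Lipschitz curve $x:[0,T]\to\mathbb{R}^d$ (for some $T>0$) with $x(0)=x_0$ and $(g\circ x)'(t)=-|\nabla g|(x(t))$ for a.e. $t\in[0,T]$. *)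

(* Defs.v *)
From HB Require Import structures.
From mathcomp Require Import all_boot all_order all_algebra.
From mathcomp Require Import all_classical all_reals all_analysis.

Set Implicit Arguments.
Unset Strict Implicit.
Unset Printing Implicit Defensive.

Import Order.TTheory GRing.Theory Num.Theory.
Import numFieldNormedType.Exports.

Local Open Scope classical_set_scope.
Local Open Scope ring_scope.

(* The library's norm on ['rV[R]_d] is the sup norm; the two norms define the
   same topology, so [nbhs x] below is the Euclidean neighbourhood filter. *)
Definition enorm (R : realType) (d : nat) (x : 'rV[R]_d) : R :=
  Num.sqrt (\sum_(i < d) x ord0 i ^+ 2).

Definition eball (R : realType) (d : nat) (x : 'rV[R]_d) (r : R) :
    set 'rV[R]_d :=
  [set y | enorm (y - x) < r].

Definition edom (R : realType) (d : nat) (g : 'rV[R]_d -> \bar R) :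
    set 'rV[R]_d :=
  [set x | (g x < +oo)%E].

Definition argmin (R : realType) (d : nat) (g : 'rV[R]_d -> \bar R) :
    set 'rV[R]_d :=
  [set x | forall y, (g x <= g y)%E].

Definition sublevel (R : realType) (d : nat) (g : 'rV[R]_d -> \bar R)
    (a : \bar R) : set 'rV[R]_d :=
  [set x | (g x <= a)%E].

Definition quasiconvex (R : realType) (d : nat) (g : 'rV[R]_d -> \bar R) :
    Prop :=
  forall (x y : 'rV[R]_d) (t : R), 0 <= t -> t <= 1 ->
    (g (t *: x + (1 - t) *: y)%R <= maxe (g x) (g y))%E.

Definition locally_lipschitz (R : realType) (d : nat) (f : 'rV[R]_d -> R) :
    Prop :=
  forall x : 'rV[R]_d, exists r L : R, 0 < r /\
    forall y z, eball x r y -> eball x r z -> `|f y - f z| <= L * enorm (y - z).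

Definition is_proj (R : realType) (d : nat) (x : 'rV[R]_d)
    (S : set 'rV[R]_d) (p : 'rV[R]_d) : Prop :=
  S p /\ forall q, S q -> enorm (x - p) <= enorm (x - q).

(* Meaningful when [S] is nonempty, closed and convex, in which case the
   nearest point exists and is unique. *)
Definition eproj (R : realType) (d : nat) (x : 'rV[R]_d)
    (S : set 'rV[R]_d) : 'rV[R]_d :=
  get [set p | is_proj x S p].

(* Since [0^-1 = 0], the term [y = x] contributes 0 to this upper limit of
   nonnegative quantities. It is therefore harmless, and it gives the usual
   value 0 of the slope when [d = 0]. *)
Definition slope (R : realType) (d : nat) (g : 'rV[R]_d -> \bar R)
    (x : 'rV[R]_d) : \bar R :=
  if (g x < +oo)%E then
    limf_esup (fun y => (maxe (g x - g y) 0 * ((enorm (x - y)%R)^-1)%:E)%E)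
      (nbhs x)
  else +oo%E.

(* The filter is that of [(y, g y) --> (x, g x)]; [y = x] is allowed. *)
Definition limiting_slope (R : realType) (d : nat) (g : 'rV[R]_d -> \bar R)
    (x : 'rV[R]_d) : \bar R :=
  limf_einf (slope g)
    (filter_from (nbhs (x, g x)) (fun V => [set y | V (y, g y)])).

(* [c] is defined on all of [R], but only its values on [0, T] matter, as the two
   endpoints are negligible. [fine] sends infinite values to 0, hence the
   finiteness condition around [t]. *)
Definition steepest_descent_curve (R : realType) (d : nat)
    (g : 'rV[R]_d -> \bar R) (x0 : 'rV[R]_d) (T : R) (c : R -> 'rV[R]_d) :
    Prop :=
  [/\ 0 < T,
      c 0 = x0,
      (forall s t : R, 0 <= s <= T -> 0 <= t <= T ->
         enorm (c s - c t) <= `|s - t|) &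
      {ae (@lebesgue_measure R), forall t : R, 0 <= t <= T ->
         (\forall s \near t, g (c s) \is a fin_num) /\
         exists2 v : R, is_derive t 1 (fun s : R => fine (g (c s))) v &
                        (v%:E = - slope g (c t))%E}].

Definition admits_steepest_descent (R : realType) (d : nat)
    (g : 'rV[R]_d -> \bar R) (x0 : 'rV[R]_d) : Prop :=
  exists (T : R) (c : R -> 'rV[R]_d), steepest_descent_curve g x0 T c.

Definition ebox (R : realType) (d : nat) (a b : 'rV[R]_d) : set 'rV[R]_d :=
  [set x | forall i, a ord0 i <= x ord0 i <= b ord0 i].

(* Lebesgue outer measure on R^d. The predicate [P] makes finite (and empty)
   covers available, which only matters when [d = 0], where every box has
   volume 1. *)
Definition lebesgue_outer (R : realType) (d : nat) (A : set 'rV[R]_d) :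
    \bar R :=
  ereal_inf [set v | exists (P : pred nat) (a b : nat -> 'rV[R]_d),
    [/\ forall n i, a n ord0 i <= b n ord0 i,
        A `<=` \bigcup_(n in [set n | P n]) ebox (a n) (b n) &
        v = (\sum_(0 <= n <oo | P n)
               (\prod_(i < d) (b n ord0 i - a n ord0 i))%:E)%E]].

Definition ae_on (R : realType) (d : nat) (A : set 'rV[R]_d)
    (P : 'rV[R]_d -> Prop) : Prop :=
  lebesgue_outer (A `&` [set x | ~ P x]) = 0%E.

Definition inf_reg (R : realType) (d : nat) (eps : R)
    (g : 'rV[R]_d -> \bar R) (x : 'rV[R]_d) : \bar R :=
  ereal_inf [set g (x - eps *: w) | w in [set w | enorm w <= 1]].

Definition U_set (R : realType) (d : nat) (eps : R)
    (g : 'rV[R]_d -> \bar R) : set 'rV[R]_d :=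
  [set x | (0 < limiting_slope g (eproj x (sublevel g (inf_reg eps g x))))%E].

(* Main.v *)
Require Import Defs.
From HB Require Import structures.
From mathcomp Require Import all_boot all_order all_algebra.
From mathcomp Require Import all_classical all_reals all_analysis.
From mathcomp Require Import ring lra.

Set Implicit Arguments.
Unset Strict Implicit.
Unset Printing Implicit Defensive.

Import Order.TTheory GRing.Theory Num.Theory.
Import numFieldNormedType.Exports.

Local Open Scope classical_set_scope.
Local Open Scope ring_scope.

(** Write [g] for the regularization of [f] and, for a point [z], let [M z] be
    the set of minimizers of [f] on the closed ball of radius [eps] around [z],
    so that [g z] is the value of [f] on [M z]. A steepest descent curve of [g]
    is shown to exist at every point considered; the exceptional null set is
    empty.

    If [x] minimizes [g], the constant curve works. Otherwise the hypotheses
    give a point [p] of [M x], nearest to [x], near which [f] has no local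
    minimizer (a local minimizer has slope 0). A point of [M z] interior to the
    ball would be a local minimizer of [f]; hence [p], and with it the whole of
    [M x], lies on the sphere, and [M x], being convex, reduces to [p]. By
    compactness [M] is upper semicontinuous, so for all [z]
    near [x] the set [M z] is close to [p], lies on the sphere as well, and is a
    single point [q z] depending continuously on [z]. Three facts follow near
    [x] for the unit vector field [v z = (q z - z) / eps]:
    - [v] is continuous ([inner_normal_continuous]);
    - [v z] is an inner normal at [z] to the convex sublevel set of [g] through
      [z] ([inner_normal_support]), because [q z] is the projection of [z] on
      the sublevel set of [f] at level [g z];
    - [g] decreases strictly in the direction [v z] ([descent_along_normal]),
      since moving along [v z] brings [q z] into the interior of the ball.

    Peano's theorem ([peano]) gives a 1-Lipschitz curve [c] with [c 0 = x] and
    [c' = v c]. As [g] is Lipschitz near [x], the real function [g \o c] is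
    Lipschitz, hence differentiable almost everywhere
    ([lipschitz_ae_derivable]). At a time [t] of differentiability the slope of
    [g] at [z = c t] is [- (g \o c)' t] ([slope_along]). It is at least that
    because [c] has speed at most 1. Conversely, a point [y] near [z] with
    [g y < g z] lies on the level of some [c (t + s)] with [s] small; the
    supporting hyperplane at [c (t + s)], whose normal is close to the velocity
    [v z], separates [y] from [z], so that [y] is at distance at least
    [s * (1 - o(1))] from [z]. *)

(** * The Euclidean norm *)

Section Euclid.
Context {R : realType} {d : nat}.
Implicit Types x y z u v : 'rV[R]_d.

Definition edot x y : R := \sum_(i < d) x ord0 i * y ord0 i.

Lemma edotC x y : edot x y = edot y x.
Proof. by apply: eq_bigr => i _; rewrite mulrC. Qed.

Lemma edotDl x y z : edot (x + y) z = edot x z + edot y z.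
Proof.
by rewrite -big_split/=; apply: eq_bigr => i _; rewrite mxE mulrDl.
Qed.

Lemma edotZl a x y : edot (a *: x) y = a * edot x y.
Proof. by rewrite mulr_sumr; apply: eq_bigr => i _; rewrite mxE mulrA. Qed.

Lemma edotNl x y : edot (- x) y = - edot x y.
Proof. by rewrite -scaleN1r edotZl mulN1r. Qed.

Lemma edotBl x y z : edot (x - y) z = edot x z - edot y z.
Proof. by rewrite edotDl edotNl. Qed.

Lemma edotDr x y z : edot z (x + y) = edot z x + edot z y.
Proof. by rewrite edotC edotDl !(edotC z). Qed.

Lemma edotZr a x y : edot x (a *: y) = a * edot x y.
Proof. by rewrite edotC edotZl edotC. Qed.

Lemma edotNr x y : edot x (- y) = - edot x y.
Proof. by rewrite edotC edotNl edotC. Qed.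

Lemma edotBr x y z : edot z (x - y) = edot z x - edot z y.
Proof. by rewrite edotDr edotNr. Qed.

Definition edotE := (edotDl, edotDr, edotBl, edotBr, edotZl, edotZr, edotNl,
  edotNr).

Lemma enorm_ge0 x : 0 <= enorm x.
Proof. exact: sqrtr_ge0. Qed.

Lemma sqr_enorm x : enorm x ^+ 2 = edot x x.
Proof.
rewrite /enorm sqr_sqrtr; first by apply: eq_bigr => i _; rewrite expr2.
by apply: sumr_ge0 => i _; rewrite sqr_ge0.
Qed.

Lemma enormZ a x : enorm (a *: x) = `|a| * enorm x.
Proof.
apply/eqP; rewrite -(@eqrXn2 _ 2)// ?mulr_ge0 ?enorm_ge0//.
by rewrite exprMn !sqr_enorm !edotE real_normK ?num_real// mulrA expr2.
Qed.

Lemma enorm0 : enorm (0 : 'rV[R]_d) = 0.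
Proof. by rewrite -(scale0r 0) enormZ normr0 mul0r. Qed.

Lemma enormN x : enorm (- x) = enorm x.
Proof. by rewrite -scaleN1r enormZ normrN1 mul1r. Qed.

Lemma enormB x y : enorm (x - y) = enorm (y - x).
Proof. by rewrite -enormN opprB. Qed.

Lemma enorm_eq0 x : enorm x = 0 -> x = 0.
Proof.
move=> x0; have : edot x x = 0 by rewrite -sqr_enorm x0 expr0n.
move=> /eqP; rewrite psumr_eq0 => [/allP x2|i _]; last first.
  by rewrite -expr2 sqr_ge0.
apply/rowP => i; rewrite mxE; apply/eqP.
by have := x2 i (mem_index_enum _); rewrite mulf_eq0 orbb.
Qed.

Lemma sqr_enormD x y :
  enorm (x + y) ^+ 2 = enorm x ^+ 2 + 2 * edot x y + enorm y ^+ 2.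
Proof. by rewrite !sqr_enorm !edotE (edotC y x); ring. Qed.

Lemma sqr_enormB x y :
  enorm (x - y) ^+ 2 = enorm x ^+ 2 - 2 * edot x y + enorm y ^+ 2.
Proof. by rewrite sqr_enormD enormN edotNr mulrN. Qed.

Lemma cauchy_schwarz x y : edot x y <= enorm x * enorm y.
Proof.
have [->|y0] := eqVneq y 0.
  by rewrite -(scale0r 0) edotZr enormZ normr0 !mul0r mulr0.
have ny : 0 < enorm y.
  rewrite lt_neqAle enorm_ge0 andbT eq_sym; apply/eqP => /enorm_eq0.
  exact/eqP.
apply: le_trans (ler_norm _) _.
rewrite -(@ler_pXn2r _ 2)// ?nnegrE ?mulr_ge0 ?enorm_ge0//.
rewrite real_normK ?num_real// exprMn.
have := sqr_ge0 (enorm (enorm y ^+ 2 *: x - edot x y *: y)).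
rewrite sqr_enormB !enormZ !exprMn !real_normK ?num_real// !edotE => h.
(* [h] is nonnegativity of the squared norm of [|y|^2 x - <x, y> y]. *)
rewrite -(ler_pM2l (exprn_gt0 2 ny)); move: h.
set a := enorm y; set b := edot x y; set c := enorm x; nra.
Qed.

Lemma enormD x y : enorm (x + y) <= enorm x + enorm y.
Proof.
rewrite -(@ler_pXn2r _ 2)// ?nnegrE ?addr_ge0 ?enorm_ge0//.
rewrite sqr_enormD sqrrD.
by have := cauchy_schwarz x y; lra.
Qed.

Lemma enorm_triangle y x z : enorm (x - z) <= enorm (x - y) + enorm (y - z).
Proof. by have := enormD (x - y) (y - z); rewrite addrA subrK. Qed.

Lemma enorm_sum (I : Type) (s : seq I) (P : pred I) (F : I -> 'rV[R]_d) :
  enorm (\sum_(i <- s | P i) F i) <= \sum_(i <- s | P i) enorm (F i).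
Proof.
elim/big_ind2 : _ => [|x a y b xa yb|//]; first by rewrite enorm0.
by rewrite (le_trans (enormD _ _))// lerD.
Qed.

(** Together with [enorm_le_norm], this says that the Euclidean norm and the sup
    norm, which defines the topology of ['rV[R]_d], are equivalent. *)
Lemma norm_le_enorm x : `|x| <= enorm x.
Proof.
rewrite [leLHS]mx_normrE; apply/bigmax_leP; split; first exact: enorm_ge0.
move=> -[i j] _ /=; rewrite (ord1 i) -sqrtr_sqr ler_wsqrtr//.
by rewrite (bigD1 j)//= lerDl sumr_ge0// => k _; rewrite sqr_ge0.
Qed.

Lemma enorm_le_norm x : enorm x <= d%:R * `|x|.
Proof.
rewrite [leLHS](_ : enorm x = enorm (\sum_j x ord0 j *: 'e_j)); last first.
  by rewrite -row_sum_delta.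
apply: le_trans (enorm_sum _ _ _) _.
rewrite -[d in d%:R]card_ord -sumr_const mulr_suml ler_sum// => j _.
rewrite enormZ.
have -> : enorm ('e_j : 'rV[R]_d) = 1.
  rewrite /enorm (bigD1 j)//= big1 => [|k kj].
    by rewrite mxE !eqxx expr1n addr0 sqrtr1.
  by rewrite mxE (negPf kj) andbF expr0n.
rewrite mulr1 mul1r [leRHS]mx_normrE.
by apply/bigmax_geP; right => /=; exists (ord0, j).
Qed.

Lemma nbhs_eball x r : 0 < r -> nbhs x (eball x r).
Proof.
move=> r0; apply/nbhs_ballP; exists (r / (d%:R + 1)) => /=.
  by rewrite divr_gt0// ltr_wpDl.
move=> y; rewrite -ball_normE/= /eball/= => xy.
apply: le_lt_trans (enorm_le_norm _) _.
have : (d%:R + 1) * `|y - x| < r.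
  by rewrite mulrC -ltr_pdivlMr ?ltr_wpDl// distrC.
by apply: le_lt_trans; rewrite ler_wpM2r// lerDl.
Qed.

Lemma nbhs_eballP x (A : set 'rV[R]_d) :
  nbhs x A <-> exists2 r, 0 < r & eball x r `<=` A.
Proof.
split=> [/nbhs_ballP[r r0 rA]|[r r0 rA]]; last first.
  by have := nbhs_eball x r0; apply: filterS.
exists r => // y yx; apply: rA; rewrite -ball_normE/= distrC.
exact: le_lt_trans (norm_le_enorm _) yx.
Qed.

Lemma eball_continuousP (h : 'rV[R]_d -> R) x :
  {for x, continuous h} <->
  (forall e, 0 < e -> exists2 r, 0 < r & forall y, enorm (y - x) < r ->
    `|h y - h x| < e).
Proof.
split=> [hx e e0|hx].
  have /(@cvgrPdist_lt _ _ _ (nbhs x))/(_ e e0)/nbhs_eballP[r r0 rA] := hx.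
  by exists r => // y /rA /=; rewrite distrC.
apply/(@cvgrPdist_lt _ _ _ (nbhs x)) => e e0; apply/nbhs_eballP.
have [r r0 rA] := hx e e0.
by exists r => // y /rA /=; rewrite distrC.
Qed.

Lemma enorm_lipschitz x y : `|enorm x - enorm y| <= enorm (x - y).
Proof.
rewrite ler_norml lerBlDr lerBrDr.
have := enormD (x - y) y; have := enormD (y - x) x.
by rewrite !subrK [enorm (y - x)]enormB; lra.
Qed.

Lemma enormB_continuous y : continuous (fun x => enorm (x - y)).
Proof.
move=> x; apply/eball_continuousP => e e0; exists e => // z.
apply: le_lt_trans; rewrite (le_trans (enorm_lipschitz _ _))//.
by rewrite opprB addrA subrK.
Qed.

Lemma compact_eclosed_ball x r : compact [set y | enorm (y - x) <= r].
Proof.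
apply: bounded_closed_compact.
  exists (`|x| + r); split; first exact: num_real.
  move=> M rM y /= yr; apply: le_trans (ltW rM).
  rewrite -lerBlDl (le_trans _ yr)// (le_trans _ (norm_le_enorm _))//.
  by rewrite lerBlDl -{1}(subrK x y) addrC ler_normD.
exact: (preimage_closed (fun z _ => @enormB_continuous x z) (@closed_le _ r)).
Qed.

End Euclid.

(** * Almost everywhere differentiability of Lipschitz functions *)

(** Precomposing with the retraction of the line onto [[0, b]] turns a function
    that is Lipschitz on [[0, b]] into a function that is Lipschitz on the whole
    line. *)
Definition clamp (R : realType) (b t : R) : R := Num.max 0 (Num.min t b).

Lemma clampP (R : realType) (b s t : R) : 0 <= b -> s <= t ->
  [/\ 0 <= clamp b s, clamp b s <= clamp b t, clamp b t <= b &
      clamp b t - clamp b s <= t - s].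
Proof.
by move=> b0 st; rewrite /clamp /Num.max /Num.min; do !case: ifP; split; lra.
Qed.

Lemma clamp_id (R : realType) (b t : R) : 0 <= t <= b -> clamp b t = t.
Proof. by move=> /andP[t0 tb]; rewrite /clamp min_l// max_r. Qed.

Lemma lebesgue_stieltjes_itvoc (R : realType) (F : cumulative R R) (a b : R) :
  a <= b -> lebesgue_stieltjes_measure F `]a, b] = (F b - F a)%:E.
Proof.
move=> ab; rewrite /lebesgue_stieltjes_measure /measure_extension.
rewrite measurable_mu_extE/=; last exact: is_ocitv.
by rewrite wlength_itv_bnd.
Qed.

(** The measures of [F] and [H] add up to a measure that agrees with Lebesgue
    measure on intervals, hence everywhere. *)
Lemma lebesgue_stieltjes_le_lebesgue (R : realType) (F H : cumulative R R)
    (A : set (measurableTypeR R)) : (forall t, F t + H t = t) -> measurable A ->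
  (lebesgue_stieltjes_measure F A <= @lebesgue_measure R A)%E.
Proof.
move=> FH mA.
have -> : lebesgue_measure A = measure_add (lebesgue_stieltjes_measure F)
    (lebesgue_stieltjes_measure H) A.
  apply: lebesgue_measure_unique => // X /ocitvP[->|[[a b] /= ab ->]].
    by rewrite !measure0.
  transitivity ((F b - F a)%:E + (H b - H a)%:E)%E; last first.
    apply: esym; apply: etrans (measure_addE _ _ _) _; congr (_ + _)%E;
      exact: lebesgue_stieltjes_itvoc (ltW ab).
  rewrite lebesgue_measure_itv/= lte_fin ab -!EFinD.
  congr EFin; rewrite -{1}(FH a) -{1}(FH b); ring.
by rewrite measure_addE leeDl.
Qed.

Lemma contraction_right_continuous (R : realType) (F : R -> R) :
  (forall s t, s <= t -> 0 <= F t - F s <= t - s) -> right_continuous F.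
Proof.
move=> Fl; apply: right_continuousW => x.
apply/cvgrPdist_le => e e0; near=> t.
apply: (@le_trans _ _ `|x - t|); last first.
  by near: t; apply: cvgr_dist_le.
have [xt|/ltW tx] := leP x t.
  have /andP[? ?] := Fl _ _ xt.
  by rewrite distrC [leRHS]distrC !ger0_norm ?subr_ge0//; lra.
have /andP[? ?] := Fl _ _ tx.
by rewrite !ger0_norm ?subr_ge0//; lra.
Unshelve. all: by end_near. Qed.

(** The Lebesgue-Stieltjes measure of [F] is dominated by Lebesgue measure, so
    it has a Radon-Nikodym density, and [F] is up to a constant the indefinite
    integral of that density; Lebesgue's differentiation theorem concludes. *)
Lemma nondecreasing_contraction_ae_derivable (R : realType) (F : R -> R)
    (T : R) : 0 < T ->
  (forall s t, s <= t -> 0 <= F t - F s <= t - s) ->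
  {ae (@lebesgue_measure R), forall t : R, 0 < t < T -> derivable F t 1}.
Proof.
move=> T0 Fl.
have Hl s t : s <= t -> 0 <= (t - F t) - (s - F s) <= t - s.
  by move=> /Fl; lra.
have ndF : {homo F : x y / x <= y} by move=> x y /Fl; lra.
have ndH : {homo (fun t => t - F t) : x y / x <= y} by move=> x y /Hl; lra.
pose mF := isCumulative.Build R _ R F ndF (contraction_right_continuous Fl).
pose Fc : cumulative R R := HB.pack F mF.
pose mH := isCumulative.Build R _ R (fun t => t - F t) ndH
  (contraction_right_continuous Hl).
pose Hc : cumulative R R := HB.pack (fun t => t - F t) mH.
have ls_le A : measurable A ->
    (lebesgue_stieltjes_measure Fc A <= @lebesgue_measure R A)%E.
  by apply: (@lebesgue_stieltjes_le_lebesgue _ _ Hc) => t /=; ring.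
(* The restriction to a bounded interval makes the measure finite, hence a
   charge. *)
pose D : set (measurableTypeR R) := `]0, T]%classic.
have mD : measurable D by exact: measurable_itv.
have Doo : (lebesgue_stieltjes_measure Fc D < +oo)%E.
  by rewrite lebesgue_stieltjes_itvoc ?ltW// ltry.
pose nu := charge_of_finite_measure (mfrestr mD Doo).
have numu : nu `<< (@lebesgue_measure R).
  move=> A A0 B mB BA; apply/eqP; rewrite -measure_le0 -(A0 _ mB BA).
  apply: le_trans (ls_le _ mB).
  apply: le_measure; rewrite ?inE; [|exact: mB|exact: subIsetl].
  exact: measurableI.
have h_fin := Radon_Nikodym_fin_num _ numu.
have h_int := Radon_Nikodym_integrable numu.
have h_nu := Radon_Nikodym_integral numu.
set h := Radon_Nikodym _ _ in h_fin h_int h_nu.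
have hE : EFin \o (fine \o h) = h by apply/funext => t /=; rewrite fineK.
have int_h : (@lebesgue_measure R).-integrable setT (EFin \o (fine \o h)).
  by rewrite hE.
have loc_h : locally_integrable setT (fine \o h).
  by apply: open_integrable_locally => //; exact: openT.
have int_hy y : (@lebesgue_measure R).-integrable `]-oo, y]
    (EFin \o (fine \o h)).
  by apply: integrableS int_h => //.
have := FTC1Ny int_hy loc_h.
apply: filterS; first exact: (ae_filter_ringOfSetsType (@lebesgue_measure R)).
move=> t [dt _] /andP[t0 tT].
set I := (fun x : R => _) in dt.
have IE x : 0 < x < T -> F x = I x + F 0.
  move=> /andP[x0 xT]; rewrite /I /Rintegral.
  have -> : (\int[lebesgue_measure]_(t0 in `]-oo, x]) ((fine \o h) t0)%:E =
     \int[lebesgue_measure]_(t0 in `]-oo, x]) h t0)%E.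
    by apply: eq_integral => y _; rewrite -[in RHS]hE.
  rewrite -h_nu//= /nu /charge_of_finite_measure /mfrestr /mrestr.
  have -> : (`]-oo, x] `&` `]0, T] = `]0, x])%classic.
    apply/seteqP; split=> y /=; rewrite !in_itv/=.
      by move=> [? /andP[-> _]].
    by move=> /andP[-> yx]; split=> //; rewrite (le_trans yx)// ltW.
  by rewrite lebesgue_stieltjes_itvoc ?ltW//= subrK.
have : derivable (fun x => I x + F 0) t 1.
  by apply: derivableD; [exact: dt|exact: derivable_cst].
apply: near_eq_derivable; near=> x; symmetry; apply: IE; apply/andP; split.
  by near: x; exact: lt_nbhsr.
by near: x; exact: lt_nbhsl.
Unshelve. all: by end_near. Qed.

(** After rescaling and adding the identity, a Lipschitz function becomes a
    nondecreasing contraction. *)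
Lemma lipschitz_ae_derivable (R : realType) (F : R -> R) (K T : R) :
  0 < T -> 0 < K ->
  (forall s t, 0 <= s -> s <= t -> t <= T -> `|F t - F s| <= K * (t - s)) ->
  {ae (@lebesgue_measure R), forall t : R, 0 < t < T -> derivable F t 1}.
Proof.
move=> T0 K0 Fl.
(* Halving keeps [G] a contraction once [t] has been added to make it
   nondecreasing. *)
pose G t := (F (clamp T t) / K + t) / 2.
have GF t : K * (2 * G t - t) = F (clamp T t).
  by rewrite /G; field; rewrite gt_eqF.
have Gl s t : s <= t -> 0 <= G t - G s <= t - s.
  move=> st; have [s0 cst tT cc] := clampP (ltW T0) st.
  have := Fl _ _ s0 cst tT; rewrite -!GF.
  rewrite -mulrBr normrM (gtr0_norm K0) ler_pM2l// ler_norml => /andP[]; lra.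
have := nondecreasing_contraction_ae_derivable T0 Gl.
apply: filterS; first exact: (ae_filter_ringOfSetsType (@lebesgue_measure R)).
move=> t dG /[dup] t0T /dG dGt; have /andP[t0 tT] := t0T.
have : derivable (K \*: (2 \*: G - id)) t 1.
  apply: derivableZ; apply: derivableB; last exact: derivable_id.
  by apply: derivableZ; exact: dGt.
apply: near_eq_derivable; near=> x.
have x0 : 0 <= x by apply: ltW; near: x; exact: lt_nbhsr.
have xT : x <= T by apply: ltW; near: x; exact: lt_nbhsl.
have clampx : clamp T x = x by rewrite clamp_id// x0.
by rewrite -[in RHS]clampx -GF.
Unshelve. all: by end_near. Qed.

(** * Peano's existence theorem *)

(** Compactness in the form used to extract limits of Euler curves: a single
    ultrafilter on the indices makes the curves converge at all times at once,
    so that no diagonal argument is needed. *)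
Lemma ultra_limit (I : Type) (T : topologicalType) (U : set_system I)
    (A : set T) (u : I -> T) : UltraFilter U -> compact A ->
  (forall i, A (u i)) -> exists p : T, forall V, nbhs p V -> U (u @^-1` V).
Proof.
move=> UU cA Au.
have PU : ProperFilter U by exact: ultra_proper.
have [p [_ pU]] := cA (u @ U) _ (filterS (fun i _ => Au i) filterT).
exists p => V pV.
have [//|UV] := in_ultra_setVsetC (u @^-1` V) UU.
have [q [/= nVq Vq]] := pU (~` V) V UV pV.
by case: (nVq Vq).
Qed.

Section Euler.
Context {R : realType} {d : nat}.
Variable v : 'rV[R]_d -> 'rV[R]_d.
Hypothesis v_le1 : forall x, enorm (v x) <= 1.
Implicit Types (x w : 'rV[R]_d) (h e t s : R).

Definition euler_step h x := x + h *: v x.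

Lemma euler_dist h x k : 0 <= h ->
  enorm (iter k (euler_step h) x - x) <= k%:R * h.
Proof.
move=> h0; elim: k => [|k ih]; first by rewrite subrr enorm0 mul0r.
rewrite /= {1}/euler_step addrAC (le_trans (enormD _ _))// enormZ ger0_norm//.
by have := v_le1 (iter k (euler_step h) x); rewrite -natr1; nra.
Qed.

(** As long as the field stays [e]-close to [w] along the iterates, their total
    displacement is that of the constant field [w], up to [e] times the elapsed
    time. *)
Lemma euler_approx h x w e k : 0 <= h ->
  (forall j, (j < k)%N -> enorm (v (iter j (euler_step h) x) - w) <= e) ->
  enorm (iter k (euler_step h) x - x - (k%:R * h) *: w) <= k%:R * h * e.
Proof.
move=> h0; elim: k => [|k ih] ve.
  by rewrite !mul0r scale0r subr0 subrr enorm0.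
have -> : iter k.+1 (euler_step h) x - x - (k.+1%:R * h) *: w =
    (iter k (euler_step h) x - x - (k%:R * h) *: w) +
    h *: (v (iter k (euler_step h) x) - w).
  by apply/rowP => i; rewrite /= {1}/euler_step !mxE -natr1; ring.
rewrite (le_trans (enormD _ _))// -natr1 [(_ + 1) * h]mulrDl mulrDl lerD//.
  by apply: ih => j jk; apply: ve; exact: ltnW.
by rewrite enormZ ger0_norm// mul1r ler_wpM2l// ve.
Qed.

Definition mesh (N : nat) : R := N.+1%:R^-1.

(** The scheme is kept piecewise constant in time; the jumps have size at most
    [mesh N], so they disappear in the limit. *)
Definition euler_curve x0 (N : nat) t :=
  iter (Num.truncn (t / mesh N)) (euler_step (mesh N)) x0.

Lemma mesh_gt0 N : 0 < mesh N. Proof. by rewrite invr_gt0. Qed.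

Lemma truncn_mesh N t : 0 <= t ->
  (Num.truncn (t / mesh N))%:R * mesh N <= t <
  (Num.truncn (t / mesh N))%:R * mesh N + mesh N.
Proof.
move=> t0; have := truncn_itv (divr_ge0 t0 (ltW (mesh_gt0 N))).
by rewrite ler_pdivlMr ?ltr_pdivrMr ?mesh_gt0// -natr1 mulrDl mul1r.
Qed.

Lemma euler_curveD x0 N t s : 0 <= t -> 0 <= s ->
  exists k, [/\ euler_curve x0 N (t + s) =
    iter k (euler_step (mesh N)) (euler_curve x0 N t),
    k%:R * mesh N < s + mesh N & s - mesh N < k%:R * mesh N].
Proof.
move=> t0 s0; set i := Num.truncn (t / mesh N).
set j := Num.truncn ((t + s) / mesh N).
have ij : (i <= j)%N.
  by apply: le_truncn; rewrite ler_pM2r ?invr_gt0 ?mesh_gt0// lerDl.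
exists (j - i)%N; rewrite /euler_curve -/i -/j -iterD subnK//; split=> //.
all: rewrite natrB// mulrBl.
all: have /andP[] := truncn_mesh N t0.
all: have /andP[] := truncn_mesh N (addr_ge0 t0 s0).
all: rewrite -/i -/j; lra.
Qed.

Lemma mesh_lt e : 0 < e -> \forall N \near \oo, mesh N < e.
Proof. by move=> e0; exact: near_infty_natSinv_lt (PosNum e0). Qed.

(** Peano's existence theorem, localized: the velocity is [v (c t)] at the times
    [t] such that [v] is continuous at [c t]. This form suits a field defined by
    an arbitrary choice outside the region of interest, as it needs no extension
    or cut-off of the field. *)
Lemma peano x0 : exists c : R -> 'rV[R]_d,
  [/\ c 0 = x0,
   (forall s t, 0 <= s -> 0 <= t -> enorm (c s - c t) <= `|s - t|) &
   forall t, 0 <= t ->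
     (forall e, 0 < e -> exists2 r, 0 < r &
        forall y, enorm (y - c t) < r -> enorm (v y - v (c t)) <= e) ->
     forall e, 0 < e -> exists2 r, 0 < r &
        forall s, 0 <= s <= r ->
          enorm (c (t + s) - c t - s *: v (c t)) <= e * s].
Proof.
have [U [UU ooU]] := ultraFilterLemma eventually_filter.
have PU : ProperFilter U by exact: ultra_proper.
have ucv t : exists p, 0 <= t ->
    forall e, 0 < e -> \forall N \near U, enorm (euler_curve x0 N t - p) < e.
  have [t0|t0] := leP 0 t; last by exists 0.
  have [N|p up] := ultra_limit UU (@compact_eclosed_ball _ _ x0 t)
    (u := euler_curve x0 ^~ t).
    apply: le_trans (euler_dist _ _ (ltW (mesh_gt0 N))) _.
    by have /andP[] := truncn_mesh N t0.
  exists p => _ e e0; exact: (up (eball p e) (nbhs_eball p e0)).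
have {ucv}[c cP] := choice ucv.
have c_sub s t e : 0 <= s -> 0 <= t -> 0 < e -> \forall N \near U,
    enorm (euler_curve x0 N s - c s) < e /\
    enorm (euler_curve x0 N t - c t) < e /\ mesh N < e.
  move=> s0 t0 e0; near=> N; split; last split.
  - by near: N; exact: cP.
  - by near: N; exact: cP.
  - by near: N; apply: ooU; exact: mesh_lt.
exists c; split.
- apply/eqP; rewrite -subr_eq0; apply/eqP/enorm_eq0/eqP.
  rewrite eq_le enorm_ge0 andbT; apply/ler_addgt0Pr => e e0.
  have [N [_ [+ _]]] := filter_ex (c_sub 0 0 e (lexx _) (lexx _) e0).
  by rewrite /euler_curve mul0r truncn0 /= enormB add0r => /ltW.
- move=> s t; wlog st : s t / s <= t => [wl s0 t0|s0 t0].
    have [st|/ltW ts] := leP s t; first exact: wl.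
    by rewrite enormB distrC; exact: wl.
  apply/ler_addgt0Pr => e e0.
  have e30 : 0 < e / 3 by rewrite divr_gt0.
  have [N [cs [ct me]]] := filter_ex (c_sub s t _ s0 t0 e30).
  have ts0 : 0 <= t - s by rewrite subr_ge0.
  have [k [tE k1 k2]] := euler_curveD x0 N s0 ts0.
  rewrite addrC subrK in tE.
  have h := euler_dist (euler_curve x0 N s) k (ltW (mesh_gt0 N)).
  rewrite -tE in h.
  rewrite distrC ger0_norm// enormB.
  have := enorm_triangle (euler_curve x0 N t) (c t) (c s).
  have := enorm_triangle (euler_curve x0 N s) (euler_curve x0 N t) (c s).
  rewrite [enorm (c t - euler_curve _ _ _)]enormB; lra.
- move=> t t0 vc e e0; have [r r0 rv] := vc e e0.
  exists (r / 2); first by rewrite divr_gt0.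
  move=> s /andP[s0 sr]; apply/ler_addgt0Pr => e' e'0.
  (* [a] bounds the mesh and the distance of the Euler curve to [c]; the errors
     add up to [a * (3 + e)]. *)
  pose a := Num.min (r / 2) (e' / (3 + e)).
  have a0 : 0 < a by rewrite lt_min !divr_gt0// addr_gt0.
  have [N [cts [ct me]]] := filter_ex (c_sub _ _ _ (addr_ge0 t0 s0) t0 a0).
  have [k [tE k1 k2]] := euler_curveD x0 N t0 s0.
  set X := euler_curve x0 N (t + s) in cts tE.
  set Y := euler_curve x0 N t in ct tE.
  have m0 := mesh_gt0 N.
  have ar : a <= r / 2 by rewrite ge_min lexx.
  have ae : a * (3 + e) <= e'.
    by rewrite -ler_pdivlMr ?addr_gt0// ge_min lexx orbT.
  have /(euler_approx (ltW m0)) : forall j, (j < k)%N ->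
      enorm (v (iter j (euler_step (mesh N)) Y) - v (c t)) <= e.
    move=> j jk; apply: rv.
    apply: le_lt_trans (enorm_triangle Y _ _) _.
    have := euler_dist Y j (ltW m0).
    have : (j%:R + 1) * mesh N <= k%:R * mesh N.
      by rewrite ler_wpM2r ?(ltW m0)// natr1 ler_nat.
    by rewrite mulrDl mul1r; lra.
  rewrite -tE.
  have -> : c (t + s) - c t - s *: v (c t) = (c (t + s) - X) + (Y - c t) +
      (X - Y - (k%:R * mesh N) *: v (c t)) + (k%:R * mesh N - s) *: v (c t).
    by apply/rowP => i; rewrite !mxE; ring.
  move=> hX.
  have hv : enorm ((k%:R * mesh N - s) *: v (c t)) <= a.
    rewrite enormZ (@le_trans _ _ (a * 1))//; last by rewrite mulr1.
    by rewrite ler_pM ?enorm_ge0// ler_norml; lra.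
  have := enormD (c (t + s) - X + (Y - c t) +
      (X - Y - (k%:R * mesh N) *: v (c t))) ((k%:R * mesh N - s) *: v (c t)).
  have := enormD (c (t + s) - X + (Y - c t))
      (X - Y - (k%:R * mesh N) *: v (c t)).
  have := enormD (c (t + s) - X) (Y - c t).
  rewrite [enorm (c _ - X)]enormB.
  have : k%:R * mesh N * e <= (s + a) * e by rewrite ler_wpM2r ?(ltW e0)//; lra.
  by nra.
Unshelve. all: by end_near. Qed.

End Euler.

(** * Minimizers over balls of fixed radius *)

Section Geometry.
Context {R : realType} {d : nat}.
Variables (f : 'rV[R]_d -> R) (eps : R).
Implicit Types (x y z p q : 'rV[R]_d).

Definition ball_argmin z p :=
  enorm (z - p) <= eps /\ forall q, enorm (z - q) <= eps -> f p <= f q.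

Definition not_local_min p :=
  forall r, 0 < r -> exists2 q, enorm (q - p) < r & f q < f p.

(** At such a point the minimizer is unique ([sphere_argmin_unique]) and is the
    projection of [z] on the sublevel set through it, which is what makes
    [inner_normal] below a normal vector. *)
Definition sphere_argmin z := forall q, ball_argmin z q -> enorm (z - q) = eps.

(** The minimizer is arbitrary when there are several; then [regularization]
    does not depend on the choice, but [inner_normal] does. *)
Definition select z := get (ball_argmin z).

(** The real-valued version of [inf_reg], see [inf_regE]. *)
Definition regularization z := f (select z).

Definition inner_normal z := eps^-1 *: (select z - z).

Lemma ball_argmin_eq z p q : ball_argmin z p -> ball_argmin z q -> f p = f q.
Proof.
by move=> [zp pmin] [zq qmin]; apply/eqP; rewrite eq_le pmin// qmin.
Qed.

Lemma ball_argmin_le z p q : ball_argmin z p -> enorm (z - q) <= eps ->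
  f q <= f p -> ball_argmin z q.
Proof. by move=> [zp pmin] zq qp; split=> // q' /pmin; exact: le_trans. Qed.

Hypothesis eps_gt0 : 0 < eps.
Hypothesis f_cont : continuous f.

Lemma ball_argmin_ex z : exists p, ball_argmin z p.
Proof.
have z0 : [set y | enorm (y - z) <= eps] !=set0.
  by exists z; rewrite /= subrr enorm0; exact: ltW.
have [p] := compact_EVT_min z0 (@compact_eclosed_ball _ _ z eps)
    (continuous_subspaceT f_cont).
rewrite inE /= => pz pmin; exists p; rewrite /ball_argmin enormB; split=> // q.
by rewrite enormB => zq; apply: pmin; rewrite inE.
Qed.

Lemma selectP z : ball_argmin z (select z).
Proof. exact: getPex (ball_argmin_ex z). Qed.

Lemma regularization_le z q : enorm (z - q) <= eps -> regularization z <= f q.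
Proof. by have [_] := selectP z; exact. Qed.

Lemma inf_regE : inf_reg eps (EFin \o f) = EFin \o regularization.
Proof.
apply/funext => z /=; apply/eqP; rewrite eq_le; apply/andP; split.
  have [zs _] := selectP z.
  apply: ereal_inf_lbound; exists (eps^-1 *: (z - select z)) => /=.
    by rewrite enormZ gtr0_norm ?invr_gt0// ler_pdivrMl// mulr1.
  by rewrite scalerA divff ?gt_eqF// scale1r subKr.
apply: le_ereal_inf_tmp => _ [w /= w1 <-]; rewrite lee_fin regularization_le//.
by rewrite subKr enormZ gtr0_norm// ler_piMr// ltW.
Qed.

(** A minimizer of [f] on the ball that is interior to the ball is a local
    minimizer of [f]. *)
Lemma argmin_interior_local_min z q : ball_argmin z q -> not_local_min q ->
  enorm (z - q) = eps.
Proof.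
move=> [zq qmin] nq; apply/eqP; rewrite eq_le zq/= leNgt; apply/negP => zqe.
have e0 : 0 < eps - enorm (z - q) by rewrite subr_gt0.
have [q' q'q] := nq _ e0; rewrite ltNge qmin//.
by apply: le_trans (enorm_triangle q _ _) _; rewrite [enorm (q - _)]enormB; lra.
Qed.

(** Once the old minimizer is interior to the ball, [f] takes a smaller value in
    the ball. *)
Lemma regularization_lt z y : not_local_min (select z) ->
  enorm (y - select z) < eps -> regularization y < regularization z.
Proof.
move=> nz yz; have e0 : 0 < eps - enorm (y - select z) by rewrite subr_gt0.
have [q qz qlt] := nz _ e0; apply: le_lt_trans qlt.
apply: regularization_le.
apply: le_trans (enorm_triangle (select z) _ _) _.
by rewrite [enorm (select z - _)]enormB; lra.
Qed.

Lemma inner_normal_le1 z : enorm (inner_normal z) <= 1.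
Proof.
rewrite enormZ gtr0_norm ?invr_gt0// ler_pdivrMl// mulr1 enormB.
by have [] := selectP z.
Qed.

(** Upper semicontinuity of the set of minimizers at a point [x] where it is
    reduced to [p]. Being a minimizer at [x] means that
    [h q = max (f q - f p) (|q - x| - eps)] is nonpositive, so [h] has a
    positive minimum [eta] on the compact set of points near the ball and at
    distance at least [rho] from [p]. For [z] close to [x] the minimizers [q] at
    [z] satisfy [h q < eta], which keeps them out of that set. *)
Lemma ball_argmin_usc x p rho : ball_argmin x p ->
  (forall q, ball_argmin x q -> q = p) -> 0 < rho ->
  exists2 delta, 0 < delta & forall z q, enorm (z - x) < delta ->
    ball_argmin z q -> enorm (q - p) < rho.
Proof.
move=> px pu rho0.
pose K := [set q | enorm (q - x) <= eps + 1] `&` [set q | rho <= enorm (q - p)].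
pose h q := Num.max (f q - f p) (enorm (q - x) - eps).
have cK : compact K.
  apply: compact_closedI; first exact: compact_eclosed_ball.
  exact: (preimage_closed (fun z _ => @enormB_continuous _ _ p z)
    (@closed_ge _ rho)).
have ch : continuous h.
  move=> q; apply: (@continuous_max _ _ (fun q => f q - f p)
    (fun q => enorm (q - x) - eps)).
    apply: (@continuousB _ _ _ f (cst (f p))); first exact: f_cont.
    by apply: cst_continuous.
  apply: (@continuousB _ _ _ (fun y => enorm (y - x)) (cst eps)).
    exact: enormB_continuous.
  by apply: cst_continuous.
have hK q : K q -> 0 < h q.
  move=> [qx qp]; rewrite ltNge; apply/negP; rewrite ge_max => /andP[].
  rewrite !subr_le0 => fqp qxe.
  have : ball_argmin x q by apply: ball_argmin_le px _ fqp; rewrite enormB.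
  by move/pu => qE; move: qp; rewrite /= qE subrr enorm0 leNgt rho0.
have [eta eta0 etaP] : exists2 eta, 0 < eta & forall q, K q -> eta <= h q.
  have [K0|/set0P K0] := eqVneq K set0.
    by exists 1 => // q; rewrite K0.
  have [q0] := compact_EVT_min K0 cK (continuous_subspaceT ch).
  rewrite inE => /hK hq0 q0min; exists (h q0) => // q Kq; apply: q0min.
  by rewrite inE.
have [r r0 rP] := (@eball_continuousP _ _ f p).1 (@f_cont p) _ eta0.
exists (Num.min (Num.min eta 1) r); first by rewrite !lt_min eta0 ltr01 r0.
move=> z q; rewrite !lt_min => /andP[/andP[zeta z1] zr] [zq qmin].
rewrite ltNge; apply/negP => qp.
have qx : enorm (q - x) <= eps + enorm (z - x).
  by have := enorm_triangle z q x; rewrite [enorm (q - z)]enormB; lra.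
have /etaP : K q by split=> //=; lra.
rewrite leNgt => /negP; apply; rewrite gt_max; apply/andP; split; last lra.
have : f q <= f (p + (z - x)).
  apply: qmin; have [+ _] := px.
  by have -> : z - (p + (z - x)) = x - p by apply/rowP => i; rewrite !mxE; ring.
have := rP (p + (z - x)); rewrite addrAC subrr add0r => /(_ zr).
by rewrite ltr_norml => /andP[]; lra.
Qed.

Hypothesis f_qc : forall x y (t : R), 0 <= t <= 1 ->
  f (t *: x + (1 - t) *: y) <= Num.max (f x) (f y).

(** By quasiconvexity the midpoint of two minimizers is a minimizer, hence also
    on the sphere, and the Euclidean ball is strictly convex. *)
Lemma sphere_argmin_unique z p q : sphere_argmin z ->
  ball_argmin z p -> ball_argmin z q -> q = p.
Proof.
move=> zs zp zq.
have h01 : 0 <= (2^-1 : R) <= 1 by lra.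
pose m := 2^-1 *: p + (1 - 2^-1) *: q.
have zm : z - m = 2^-1 *: ((z - p) + (z - q)).
  by apply/rowP => i; rewrite !mxE; field.
have fm : f m <= f p.
  by rewrite (le_trans (f_qc _ _ h01))// -(ball_argmin_eq zp zq) maxxx.
have [zpe _] := zp; have [zqe _] := zq.
have zme : enorm (z - m) <= eps.
  by rewrite zm enormZ ger0_norm; [have := enormD (z - p) (z - q)|]; lra.
have := zs _ (ball_argmin_le zp zme fm); rewrite zm enormZ ger0_norm; last lra.
move=> mE; apply/eqP; rewrite -subr_eq0; apply/eqP/enorm_eq0.
have : enorm ((z - p) + (z - q)) ^+ 2 = (2 * eps) ^+ 2.
  by rewrite -mE mulrA divff// mul1r.
have -> : q - p = (z - p) - (z - q) by apply/rowP => i; rewrite !mxE; ring.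
rewrite sqr_enormD => h; apply/eqP; rewrite -sqrf_eq0 sqr_enormB.
rewrite (zs _ zp) (zs _ zq) in h *; apply/eqP.
by move: h; lra.
Qed.

(** The variational inequality of a projection: if the angle were acute, moving
    slightly from [q] towards [y] would give a minimizer interior to the
    ball. *)
Lemma sphere_argmin_obtuse z q y : sphere_argmin z -> ball_argmin z q ->
  f y <= f q -> edot (y - q) (z - q) <= 0.
Proof.
move=> zs zq yq; rewrite leNgt; apply/negP => e0.
set a := edot (y - q) (z - q) in e0.
pose b := enorm (y - q) ^+ 2.
have b0 : 0 <= b by rewrite sqr_ge0.
(* [|z - m|^2 = eps^2 - 2 t a + t^2 b], and [t b <= a]. *)
pose t := a / (a + b).
have t01 : 0 < t <= 1.
  by rewrite divr_gt0 ?ltr_wpDr//= ler_pdivrMr ?ltr_wpDr// mul1r lerDl.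
have tb : t * b <= a.
  by rewrite mulrAC ler_pdivrMr ?ltr_wpDr// ler_pM2l// lerDr ltW.
pose m := t *: y + (1 - t) *: q.
have zm : z - m = (z - q) - t *: (y - q).
  by apply/rowP => i; rewrite !mxE; ring.
have fm : f m <= f q.
  by rewrite (le_trans (f_qc _ _ _)) ?ge_max ?yq ?lexx//; lra.
have zmlt : enorm (z - m) < eps.
  rewrite -(@ltr_pXn2r _ 2)// ?nnegrE ?enorm_ge0// ?(ltW eps_gt0)//.
  rewrite zm sqr_enormB enormZ edotZr (edotC (z - q)) -/a exprMn.
  rewrite real_normK ?num_real// -/b (zs _ zq).
  by nra.
have := zs _ (ball_argmin_le zq (ltW zmlt) fm); lra.
Qed.

(** The sublevel set of the regularization is contained in the
    [eps]-enlargement of the sublevel set of [f]. The latter lies in a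
    half-space whose boundary passes through [select z], and enlarging this
    half-space by [eps] moves its boundary to [z]. *)
Lemma inner_normal_support z y : sphere_argmin z ->
  regularization y <= regularization z -> 0 <= edot (y - z) (inner_normal z).
Proof.
move=> zs yz; rewrite /inner_normal edotZr mulr_ge0 ?invr_ge0 ?(ltW eps_gt0)//.
have h1 := sphere_argmin_obtuse zs (selectP z) yz.
have h2 := cauchy_schwarz (y - select y) (z - select z).
have [ye _] := selectP y.
have ze := zs _ (selectP z).
have h3 : enorm (y - select y) * enorm (z - select z) <= eps * eps.
  by rewrite ze ler_wpM2r// ltW.
have -> : y - z = (y - select y) + (select y - select z) - (z - select z).
  by apply/rowP => i; rewrite !mxE; ring.
rewrite -(opprB z (select z)) edotNr edotBl edotDl -sqr_enorm ze expr2.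
have := le_trans h2 h3; clear -h1; lra.
Qed.

Lemma inner_normal_continuous z e : sphere_argmin z -> 0 < e ->
  exists2 r, 0 < r & forall y, enorm (y - z) < r ->
    enorm (inner_normal y - inner_normal z) <= e.
Proof.
move=> zs e0.
have e2 : 0 < eps * e / 2 by rewrite divr_gt0// mulr_gt0.
have [r r0 rP] := ball_argmin_usc (selectP z)
  (fun q => sphere_argmin_unique zs (selectP z)) e2.
exists (Num.min r (eps * e / 2)); first by rewrite lt_min r0.
move=> y; rewrite lt_min => /andP[yr ye].
rewrite -scalerBr enormZ gtr0_norm ?invr_gt0// ler_pdivrMl//.
have := rP _ _ yr (selectP y); have := enormD (select y - select z) (z - y).
rewrite [enorm (z - y)]enormB.
have -> : select y - select z + (z - y) = select y - y - (select z - z).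
  by apply/rowP => i; rewrite !mxE; ring.
by lra.
Qed.

Lemma inner_normal_norm z : sphere_argmin z -> enorm (inner_normal z) = 1.
Proof.
move=> zs; rewrite enormZ gtr0_norm ?invr_gt0// enormB (zs _ (selectP z)).
by rewrite mulVf// gt_eqF.
Qed.

End Geometry.

(** * Slopes *)

Section Slope.
Context {R : realType} {d : nat}.
Implicit Types (g : 'rV[R]_d -> R) (x y : 'rV[R]_d).

(** The quotient in the definition of the slope, for a real-valued function. *)
Definition descent_quotient g x y := Num.max (g x - g y) 0 / enorm (x - y).

Lemma slope_EFin g x : slope (EFin \o g) x =
  limf_esup (fun y => (descent_quotient g x y)%:E) (nbhs x).
Proof.
rewrite /slope /= ltry; congr limf_esup; apply/funext => y.
by rewrite -EFinB -EFin_max -EFinM.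
Qed.

Lemma slope_le g x a r : 0 < r ->
  (forall y, enorm (y - x) < r -> descent_quotient g x y <= a) ->
  (slope (EFin \o g) x <= a%:E)%E.
Proof.
move=> r0 ra; rewrite slope_EFin; apply: ge_ereal_inf.
eexists; first by exists (eball x r) => //; exact: nbhs_eball.
by apply: ge_ereal_sup => _ [y yx <-]; rewrite lee_fin ra.
Qed.

Lemma slope_ge g x a :
  (forall r, 0 < r -> exists2 y, enorm (y - x) < r &
    a <= descent_quotient g x y) ->
  (a%:E <= slope (EFin \o g) x)%E.
Proof.
move=> ra; rewrite slope_EFin; apply: le_ereal_inf_tmp => _ [V + <-].
move=> /nbhs_eballP[r /ra[y yx ay] rV].
apply: le_trans (ereal_sup_ubound _); last by exists y => //; exact: rV.
by rewrite lee_fin.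
Qed.

Lemma slope_local_min g x r : 0 < r ->
  (forall y, enorm (y - x) < r -> g x <= g y) ->
  (slope (EFin \o g) x <= 0)%E.
Proof.
move=> r0 gx; apply: slope_le r0 _ => y /gx xy.
by rewrite /descent_quotient max_r ?mul0r// subr_le0.
Qed.

Lemma slope_ge0 g x : (0 <= slope (EFin \o g) x)%E.
Proof.
apply: slope_ge => r r0; exists x; first by rewrite subrr enorm0.
by rewrite /descent_quotient !subrr enorm0 invr0 mulr0.
Qed.

Lemma slope_gt0_not_local_min g x :
  (0 < slope (EFin \o g) x)%E -> not_local_min g x.
Proof.
move=> sx r r0; apply: contrapT => nq; move: sx; rewrite ltNge => /negP; apply.
apply: slope_local_min r0 _ => y yx; rewrite leNgt; apply/negP => gyx.
by apply: nq; exists y.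
Qed.

(** Since [g] is continuous at [x], convergence of [(y, g y)] to [(x, g x)] is
    convergence of [y] to [x]. *)
Lemma limiting_slope_gt0 g x : {for x, continuous g} ->
  (0 < limiting_slope (EFin \o g) x)%E ->
  exists2 r, 0 < r & forall y, enorm (y - x) < r -> not_local_min g y.
Proof.
move=> gx; rewrite /limiting_slope limf_einfE.
move=> /ereal_sup_gt[_ [V [W xW WV] <-]] V0.
have gxW : nbhs x [set y | W (y, (g y)%:E)].
  have [[A B] /= [xA xB] AB] := xW.
  have gxB : nbhs x (g @^-1` [set t | B t%:E]) by apply: gx; exact/nbhs_EFin.
  have : nbhs x (A `&` (g @^-1` [set t | B t%:E])) by exact: filterI.
  by apply: filterS => y [Ay By]; exact: (AB (y, _)).
have /nbhs_eballP[r r0 rW] := gxW.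
exists r => // y /rW /= yW; apply: slope_gt0_not_local_min.
apply: lt_le_trans V0 _; apply: ereal_inf_lbound.
by exists y => //; exact: WV.
Unshelve. all: by end_near. Qed.

End Slope.

Lemma lipschitz_IVT (R : realType) (h : R -> R) (b K v : R) : 0 <= b -> 0 < K ->
  (forall s s', 0 <= s -> s <= s' -> s' <= b ->
    `|h s' - h s| <= K * (s' - s)) ->
  h b <= v <= h 0 -> exists2 s, 0 <= s <= b & h s = v.
Proof.
move=> b0 K0 hK vh.
have hl s t : s <= t -> `|h (clamp b t) - h (clamp b s)| <= K * (t - s).
  move=> /(clampP b0)[s0 st tb cc]; rewrite (le_trans (hK _ _ s0 st tb))//.
  by rewrite ler_pM2l.
have hc : continuous (h \o clamp b).
  move=> s; apply/cvgrPdist_lt => e e0; near=> t.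
  have : `|h (clamp b s) - h (clamp b t)| <= K * `|s - t|.
    have [st|/ltW ts] := leP s t.
      by rewrite distrC (distrC s) [`|t - s|]ger0_norm ?subr_ge0//; exact: hl.
    by rewrite [`|s - t|]ger0_norm ?subr_ge0//; exact: hl.
  move=> /le_lt_trans; apply; rewrite mulrC -ltr_pdivlMr//.
  by near: t; apply: cvgr_dist_lt => //; rewrite divr_gt0.
have [|s sb hs] := @IVT _ (h \o clamp b) 0 b v b0 (continuous_subspaceT hc).
  rewrite /= !clamp_id ?lexx ?b0// ge_min le_max.
  by move: vh => /andP[-> ->]; rewrite orbT.
by rewrite in_itv/= in sb; exists s => //; rewrite -hs /= clamp_id.
Unshelve. all: by end_near. Qed.

(** * The slope along a curve that follows the inner normals *)

Section SlopeAlongCurve.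
Context {R : realType} {d : nat}.
Variables (f : 'rV[R]_d -> R) (eps : R).
Hypothesis eps_gt0 : 0 < eps.
Hypothesis f_cont : continuous f.
Hypothesis f_qc : forall x y (t : R), 0 <= t <= 1 ->
  f (t *: x + (1 - t) *: y) <= Num.max (f x) (f y).
Local Notation g := (regularization f eps).
Local Notation v := (inner_normal f eps).
Local Notation sel := (select f eps).

(** Moving from [z] by [s] along the inner normal brings the point to distance
    [eps - s] of [select z]; an error of at most [s / 2] keeps it closer than
    [eps]. *)
Lemma descent_along_normal (z : 'rV[R]_d) (y : 'rV[R]_d) (s : R) :
  sphere_argmin f eps z -> not_local_min f (sel z) ->
  0 < s <= eps -> enorm (y - z - s *: v z) <= s / 2 -> g y < g z.
Proof.
move=> zs zn /andP[s0 se] yz; apply: (regularization_lt eps_gt0) => //.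
have : enorm ((1 - s / eps) *: (z - sel z)) = eps - s.
  rewrite enormZ (zs _ (selectP eps_gt0 f_cont z)) ger0_norm.
    by field; rewrite gt_eqF.
  by rewrite subr_ge0 ler_pdivrMr// mul1r.
have := enormD (y - z - s *: v z) ((1 - s / eps) *: (z - sel z)).
have -> : y - z - s *: v z + (1 - s / eps) *: (z - sel z) = y - sel z.
  by apply/rowP => i; rewrite /inner_normal !mxE; ring.
lra.
Qed.

(** Here [gam] is a curve from [z] with unit speed bound and initial velocity
    the inner normal at [z], and [- A] is the derivative of the regularization
    along it. *)
Lemma slope_along (z : 'rV[R]_d) (gam : R -> 'rV[R]_d) (s0 K A : R) :
  0 < s0 -> 0 < K -> gam 0 = z ->
  sphere_argmin f eps z -> not_local_min f (sel z) ->
  (forall s, 0 <= s <= s0 -> sphere_argmin f eps (gam s)) ->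
  (forall s, 0 <= s <= s0 -> enorm (gam s - z) <= s) ->
  (forall s s', 0 <= s -> s <= s' -> s' <= s0 ->
     `|g (gam s') - g (gam s)| <= K * (s' - s)) ->
  {for z, continuous g} ->
  (forall e, 0 < e -> exists2 r, 0 < r & forall s, 0 <= s <= r ->
     enorm (gam s - z - s *: v z) <= e * s) ->
  (forall e, 0 < e -> exists2 r, 0 < r & forall s, 0 <= s <= r ->
     `|g (gam s) - g z + A * s| <= e * s) ->
  slope (EFin \o g) z = A%:E.
Proof.
move=> s0_gt0 K0 gam0 zs zn gams gaml gK gc hv hA.
have [r1 r10 r1P] : exists2 r, 0 < r &
    forall s, 0 < s <= r -> g (gam s) < g z.
  have [|r r0 rP] := hv 2^-1; first by rewrite invr_gt0.
  exists (Num.min r eps); first by rewrite lt_min r0.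
  move=> s; rewrite le_min => /and3P[s_gt0 sr se].
  apply: (descent_along_normal (s := s) zs zn); first by rewrite s_gt0 se.
  by rewrite [leRHS]mulrC; apply: rP; rewrite sr ltW.
have A0 : 0 <= A.
  apply/ler_addgt0Pr => e e0; have [r r0 rP] := hA e e0.
  pose s := Num.min r r1; have sp : 0 < s by rewrite lt_min r0.
  have := rP s; rewrite (ltW sp) ge_min lexx => /(_ isT).
  have := r1P s; rewrite sp ge_min lexx orbT => /(_ isT) gs.
  rewrite ler_norml => /andP[h _].
  have : 0 <= (A + e) * s by lra.
  by rewrite pmulr_lge0// addrC.
apply/eqP; rewrite eq_le; apply/andP; split; last first.
  (* Lower bound: test the slope with points of the curve. *)
  apply/lee_subgt0Pr => e e0; rewrite -EFinB; apply: slope_ge => r r0.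
  have [r2 r20 r2P] := hA e e0.
  pose s := Num.min (Num.min r2 s0) (Num.min (r / 2) r1).
  have sp : 0 < s by rewrite !lt_min r20 s0_gt0 r10 divr_gt0.
  have sr2 : s <= r2 by rewrite /s !ge_min lexx.
  have ss0 : s <= s0 by rewrite /s !ge_min lexx orbT.
  have sr : s <= r / 2 by rewrite /s !ge_min lexx !orbT.
  have sr1 : s <= r1 by rewrite /s !ge_min lexx !orbT.
  have gl : enorm (gam s - z) <= s by apply: gaml; rewrite ss0 ltW.
  have gs : g (gam s) < g z by apply: r1P; rewrite sp.
  exists (gam s); first by lra.
  have gz : 0 < enorm (z - gam s).
    rewrite lt_neqAle enorm_ge0 andbT eq_sym; apply/eqP => /enorm_eq0/eqP.
    by rewrite subr_eq0 => /eqP zE; rewrite -zE ltxx in gs.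
  rewrite /descent_quotient max_l; last by rewrite subr_ge0 ltW.
  rewrite ler_pdivlMr// enormB.
  have := r2P s; rewrite (ltW sp) sr2 => /(_ isT).
  rewrite ler_norml => /andP[_ h].
  have [Ae|Ae] := leP 0 (A - e); last by rewrite enormB in gz; nra.
  apply: (@le_trans _ _ ((A - e) * s)); last lra.
  by rewrite ler_wpM2l.
apply/lee_addgt0Pr => e e0; rewrite -EFinD.
(* Upper bound: [y] is compared with the point of the curve at the same level.
   The constant [e1] is such that [(A + e1) / (1 - 2 * e1) <= A + e]. *)
pose e1 := e / (1 + 2 * (A + e)).
have Ae : 0 < 1 + 2 * (A + e) by lra.
have e10 : 0 < e1 by rewrite divr_gt0.
have e1E : e1 * (1 + 2 * (A + e)) = e by rewrite divfK// gt_eqF.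
have [r2 r20 r2P] := hA e1 e10.
have [r3 r30 r3P] := hv e1 e10.
have [r4 r40 r4P] := inner_normal_continuous eps_gt0 f_cont f_qc zs e10.
pose b := Num.min (Num.min (Num.min r2 s0) (Num.min r3 r1)) (r4 / 2).
have bp : 0 < b by rewrite !lt_min r20 s0_gt0 r30 r10 divr_gt0.
have br2 : b <= r2 by rewrite /b !ge_min lexx.
have bs0 : b <= s0 by rewrite /b !ge_min lexx !orbT.
have br3 : b <= r3 by rewrite /b !ge_min lexx !orbT.
have br1 : b <= r1 by rewrite /b !ge_min lexx !orbT.
have br4 : b <= r4 / 2 by rewrite /b !ge_min lexx !orbT.
have gb : 0 < g z - g (gam b) by rewrite subr_gt0 r1P// bp.
have [r5 r50 r5P] := (@eball_continuousP _ _ g z).1 gc _ gb.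
apply: slope_le r50 _ => y /r5P; rewrite ltr_norml => /andP[yb _].
rewrite /descent_quotient.
have [gzy|gyz] := leP (g z) (g y).
  by rewrite max_r ?subr_le0// mul0r; lra.
rewrite max_l ?subr_ge0 ?(ltW gyz)//.
have gz : 0 < enorm (z - y).
  rewrite lt_neqAle enorm_ge0 andbT eq_sym; apply/eqP => /enorm_eq0/eqP.
  by rewrite subr_eq0 => /eqP zE; rewrite -zE ltxx in gyz.
rewrite ler_pdivrMr//.
have [||s /andP[sp sb] gs] := @lipschitz_IVT _ (g \o gam) b K (g y) (ltW bp) K0.
- by move=> s s' h1 h2 h3; apply: gK => //; lra.
- by rewrite /= gam0 (ltW gyz) andbT; lra.
rewrite /= in gs.
have s_gt0 : 0 < s.
  rewrite lt_neqAle sp andbT; apply/eqP => sE.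
  by move: gs gyz; rewrite -sE gam0 => ->; rewrite ltxx.
have hs0 : 0 <= s <= s0 by lra.
have := r2P s; rewrite sp (le_trans sb br2) => /(_ isT); rewrite gs.
rewrite ler_norml => /andP[h _].
have := r3P s; rewrite sp (le_trans sb br3) => /(_ isT) hw.
have wm : enorm (v (gam s) - v z) <= e1.
  by apply: r4P; have := gaml _ hs0; lra.
set m := v (gam s) in wm.
have sup : 0 <= edot (y - gam s) m.
  by apply: inner_normal_support => //; [exact: gams|rewrite gs].
have m1 : enorm m <= 1 by exact: inner_normal_le1.
have w1 : enorm (v z) = 1 by exact: inner_normal_norm.
have ym : edot (y - z) m <= enorm (z - y).
  rewrite enormB; apply: le_trans (cauchy_schwarz _ _) _.
  by rewrite ler_piMr ?enorm_ge0.
have hm : - (e1 * s) <= edot (gam s - z - s *: v z) m.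
  rewrite lerNl -edotNl; apply: le_trans (cauchy_schwarz _ _) _.
  rewrite enormN; apply: le_trans hw.
  by rewrite ler_piMr ?enorm_ge0.
have hwm : 1 - e1 <= edot (v z) m.
  have := cauchy_schwarz (v z) (v z - m).
  rewrite w1 mul1r edotBr -sqr_enorm w1 expr1n enormB.
  by lra.
move: ym; have -> : edot (y - z) m = edot (y - gam s) m +
    edot (gam s - z - s *: v z) m + s * edot (v z) m.
  by rewrite !edotE; ring.
move=> ym.
have hsm : s * (1 - e1) <= s * edot (v z) m by rewrite ler_pM2l.
have hN : s * (1 - 2 * e1) <= enorm (z - y) by lra.
apply: (@le_trans _ _ ((A + e) * (s * (1 - 2 * e1)))); last first.
  by rewrite ler_wpM2l//; lra.
have -> : (A + e) * (s * (1 - 2 * e1)) =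
  s * (A + e - (e1 * (1 + 2 * (A + e)) - e1)) by ring.
rewrite e1E; lra.
Qed.

End SlopeAlongCurve.

(** * Steepest descent curves of the regularization *)

Lemma derivable_right_expansion (R : realType) (F : R -> R) (t : R) :
  derivable F t 1 -> forall e, 0 < e -> exists2 r, 0 < r &
    forall s, 0 <= s <= r -> `|F (t + s) - F t - 'D_1 F t * s| <= e * s.
Proof.
move=> dF e e0; have /cvgrPdist_le/(_ e e0)[r /= r0 rP] := dF.
exists (r / 2); first by rewrite divr_gt0.
move=> s /andP[]; rewrite le_eqVlt => /predU1P[<- _|s0 sr].
  by rewrite addr0 subrr !mulr0 subr0 normr0.
have := rP s; rewrite /= sub0r normrN gtr0_norm//.
have sr' : s < r by lra.
move=> /(_ sr')/(_ (lt0r_neq0 s0)).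
have -> : s *: (1 : R) = s by rewrite -[LHS]/(s * 1) mulr1.
rewrite distrC [s + t]addrC => h.
have -> : F (t + s) - F t - 'D_1 F t * s =
    (s^-1 *: (F (t + s) - F t) - 'D_1 F t) * s.
  by rewrite mulrBl -[_^-1 *: _]/(_^-1 * _) mulrAC mulVf ?mul1r// lt0r_neq0.
by rewrite normrM (gtr0_norm s0) ler_pM2r.
Qed.

Lemma locally_lipschitz_continuous (R : realType) (d : nat)
  (f : 'rV[R]_d -> R) : locally_lipschitz f -> continuous f.
Proof.
move=> fl x; have [r [L [r0 rL]]] := fl x.
apply/eball_continuousP => e e0; have K0 : 0 < `|L| + 1 by rewrite ltr_wpDl.
exists (Num.min r (e / (`|L| + 1))); first by rewrite lt_min r0 divr_gt0.
move=> y; rewrite lt_min => /andP[yr]; rewrite ltr_pdivlMr// => ye.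
have := rL y x yr; rewrite /eball /= subrr enorm0 => /(_ r0).
have := ler_norm L; have := enorm_ge0 (y - x); nra.
Qed.

(** At a minimizer the slope vanishes. *)
Lemma constant_steepest_descent (R : realType) (d : nat) (g : 'rV[R]_d -> R)
  (x : 'rV[R]_d) : (forall y, g x <= g y) ->
  admits_steepest_descent (EFin \o g) x.
Proof.
move=> gx; exists 1, (cst x); split => //.
  by move=> s t _ _; rewrite subrr enorm0.
have s0 : slope (EFin \o g) x = 0%E.
  apply/eqP; rewrite eq_le slope_ge0 andbT.
  exact: (@slope_local_min _ _ _ _ 1).
apply: aeW => t _; split; first exact: (@filterE _ (nbhs t)).
by exists 0; [exact: (is_derive_cst (g x) t 1)|rewrite s0 oppe0].
Qed.

Section Assembly.
Context {R : realType} {d : nat}.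
Variables (f : 'rV[R]_d -> R) (eps : R).
Hypothesis eps_gt0 : 0 < eps.
Hypothesis f_lip : locally_lipschitz f.
Hypothesis f_qc : forall x y (t : R), 0 <= t <= 1 ->
  f (t *: x + (1 - t) *: y) <= Num.max (f x) (f y).
Local Notation g := (regularization f eps).
Local Notation v := (inner_normal f eps).
Local Notation sel := (select f eps).
Let f_cont := locally_lipschitz_continuous f_lip.

(** If [f] has no local minimizer near the unique minimizer [p] at [x], then the
    minimizers at the points near [x] are close to [p], so they inherit the
    properties of [p]. The regularization is Lipschitz near [x] because a
    translate of the minimizer at [z] is a competitor at [z']. *)
Lemma regular_neighbourhood x p rho : ball_argmin f eps x p ->
  sphere_argmin f eps x -> 0 < rho ->
  (forall y, enorm (y - p) < rho -> not_local_min f y) ->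
  exists delta K : R, [/\ 0 < delta, 0 < K,
    forall z, enorm (z - x) < delta ->
      sphere_argmin f eps z /\ not_local_min f (sel z) &
    forall z z', enorm (z - x) < delta -> enorm (z' - x) < delta ->
      `|g z - g z'| <= K * enorm (z - z')].
Proof.
move=> xp xs rho0 rhoP; have [r [L [r0 rL]]] := f_lip p.
have m0 : 0 < Num.min rho (r / 2) by rewrite lt_min rho0 divr_gt0.
have [delta delta0 deltaP] := ball_argmin_usc f_cont xp
  (fun q => sphere_argmin_unique f_qc xs xp) m0.
exists (Num.min delta (r / 4)), (`|L| + 1); split.
- by rewrite lt_min delta0 divr_gt0.
- by rewrite ltr_wpDl.
- move=> z; rewrite lt_min => /andP[zx _].
  have zn q : ball_argmin f eps z q -> not_local_min f q.
    by move=> /(deltaP _ _ zx); rewrite lt_min => /andP[/rhoP].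
  split; last exact/zn/selectP.
  by move=> q zq; exact: argmin_interior_local_min (zn _ zq).
- have half z z' : enorm (z - x) < Num.min delta (r / 4) ->
      enorm (z' - x) < Num.min delta (r / 4) ->
      g z' - g z <= (`|L| + 1) * enorm (z - z').
    rewrite !lt_min => /andP[zx zr] /andP[_ z'r].
    have := deltaP _ _ zx (selectP eps_gt0 f_cont z); rewrite lt_min.
    move=> /andP[_ selr].
    pose q := sel z + (z' - z).
    have qr : enorm (q - p) < r.
      have := enormD (sel z - p) ((z' - x) - (z - x)).
      have := enormD (z' - x) (- (z - x)); rewrite enormN.
      have -> : sel z - p + (z' - x - (z - x)) = q - p.
        by apply/rowP => i; rewrite !mxE; ring.
      by lra.
    have gq : g z' <= f q.
      apply: regularization_le => //.
      have -> : z' - q = z - sel z by apply/rowP => i; rewrite !mxE; ring.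
      by have [] := selectP eps_gt0 f_cont z.
    have := rL q (sel z) qr; rewrite /eball/=.
    have sr : enorm (sel z - p) < r by lra.
    move=> /(_ sr); have -> : q - sel z = z' - z by rewrite /q addrC addKr.
    rewrite [enorm (z' - z)]enormB /regularization -/g.
    have := ler_norm L; have := enorm_ge0 (z - z').
    have := ler_norm (f q - f (sel z)).
    rewrite /regularization in gq *.
    by nra.
  move=> z z' zx z'x; rewrite ler_norml; apply/andP; split; last first.
    by rewrite enormB; exact: half.
  by rewrite lerNl opprB; exact: half.
Qed.

(** The curve follows the inner normals. It stays in the neighbourhood of
    [regular_neighbourhood] up to time [delta / 2]. *)
Lemma regular_steepest_descent x p rho : ball_argmin f eps x p ->
  sphere_argmin f eps x -> 0 < rho ->
  (forall y, enorm (y - p) < rho -> not_local_min f y) ->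
  admits_steepest_descent (EFin \o g) x.
Proof.
move=> xp xs rho0 rhoP.
have [delta [K [delta0 K0 good gK]]] := regular_neighbourhood xp xs rho0 rhoP.
have [c [c0 cl cv]] := peano (inner_normal_le1 eps_gt0 f_cont) x.
pose T := delta / 2.
have T0 : 0 < T by rewrite divr_gt0.
have cx t : 0 <= t -> t <= T -> enorm (c t - x) < delta.
  move=> t0 tT; rewrite -c0; apply: le_lt_trans (cl _ _ t0 (lexx _)) _.
  by rewrite subr0 ger0_norm//; rewrite /T in tT; lra.
have Fl s t : 0 <= s -> s <= t -> t <= T ->
    `|(g \o c) t - (g \o c) s| <= K * (t - s).
  move=> s0 st tT; have t0 := le_trans s0 st; have sT := le_trans st tT.
  apply: le_trans (gK _ _ (cx _ t0 tT) (cx _ s0 sT)) _.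
  rewrite ler_pM2l//; apply: le_trans (cl _ _ t0 s0) _.
  by rewrite ger0_norm// subr_ge0.
exists T, c; split=> // [s t /andP[s0 _] /andP[t0 _]|]; first exact: cl.
have ae_neq a : {ae (@lebesgue_measure R), forall t : R, t != a}.
  exists [set a]; split; [exact: measurable_set1|exact: lebesgue_measure_set1|].
  by move=> t /= /negP; rewrite negbK => /eqP.
have FF : Filter (almost_everywhere (@lebesgue_measure R)).
  exact: (ae_filter_ringOfSetsType (@lebesgue_measure R)).
move: (ae_neq 0) (ae_neq T) (lipschitz_ae_derivable T0 K0 Fl).
apply: filterS3 => t tn0 tnT dF /andP[t0 tT].
have {}t0 : 0 < t by rewrite lt_neqAle eq_sym tn0.
have {}tT : t < T by rewrite lt_neqAle tnT.
have {}dF : derivable (g \o c) t 1 by apply: dF; rewrite t0.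
split; first exact: (@filterE _ (nbhs t)).
exists ('D_1 (g \o c) t); first exact: DeriveDef.
have ctd := cx _ (ltW t0) (ltW tT).
have [zs zn] := good _ ctd.
rewrite (@slope_along _ _ _ _ eps_gt0 f_cont f_qc (c t) (fun s => c (t + s))
  (T - t) K (- 'D_1 (g \o c) t)) ?subr_gt0 ?addr0//.
- by rewrite EFinN oppeK.
- move=> s /andP[s0 sT]; apply: (good _ _).1; apply: cx; lra.
- move=> s /andP[s0 sT]; apply: le_trans (cl _ _ _ _) _; try lra.
  by rewrite addrAC subrr add0r ger0_norm.
- move=> s s' s0 ss' s'T; apply: le_trans (Fl _ _ _ _ _) _; try lra.
- apply/eball_continuousP => e e0.
  exists (Num.min (delta - enorm (c t - x)) (e / K)).
    by rewrite lt_min subr_gt0 ctd divr_gt0.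
  move=> y; rewrite lt_min => /andP[yd]; rewrite ltr_pdivlMr// mulrC.
  apply: le_lt_trans; apply: gK => //.
  by have := enorm_triangle (c t) y x; lra.
- apply: cv; first exact: ltW.
  by move=> e e0; apply: inner_normal_continuous.
- move=> e e0; have [r r0 rP] := derivable_right_expansion dF e0.
  by exists r => // s /rP; rewrite mulNr.
Qed.

End Assembly.

Lemma lebesgue_outer0 (R : realType) (d : nat) :
  lebesgue_outer (set0 : set 'rV[R]_d) = 0%E.
Proof.
apply/eqP; rewrite eq_le; apply/andP; split.
  (* The cover is empty, as every box has volume 1 when [d = 0]. *)
  apply: ereal_inf_lbound; exists pred0, (fun=> 0), (fun=> 0); split => //.
  by rewrite eseries_pred0.
apply: le_ereal_inf_tmp => _ [P [a [b [ab _ ->]]]].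
apply: nneseries_ge0 => n _ _; rewrite lee_fin; apply: prodr_ge0 => i _.
by rewrite subr_ge0.
Qed.

Lemma ae_on_everywhere (R : realType) (d : nat) (A : set 'rV[R]_d)
    (P : 'rV[R]_d -> Prop) : (forall x, A x -> P x) -> ae_on A P.
Proof.
move=> AP; rewrite /ae_on (_ : _ `&` _ = set0) ?lebesgue_outer0//.
by apply/seteqP; split=> x // [/AP].
Qed.

(** The nearest point exists by compactness of the part of the sublevel set
    that is not farther from [x] than [q]. *)
Lemma eproj_sublevel (R : realType) (d : nat) (f : 'rV[R]_d -> R) (a : R)
    (x q : 'rV[R]_d) : continuous f -> f q <= a ->
  is_proj x (sublevel (EFin \o f) a%:E)
    (eproj x (sublevel (EFin \o f) a%:E)).
Proof.
move=> fc qa; rewrite /eproj; apply: getPex.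
pose A := [set y | enorm (y - x) <= enorm (q - x)] `&` [set y | f y <= a].
have A0 : A !=set0 by exists q; split => /=.
have cA : compact A.
  apply: compact_closedI; first exact: compact_eclosed_ball.
  exact: (preimage_closed (fun z _ => @fc z) (@closed_le _ a)).
have [p] := compact_EVT_min A0 cA
  (continuous_subspaceT (@enormB_continuous _ _ x)).
rewrite inE => -[/= pq pa] pmin; exists p; split.
  by rewrite /sublevel/= lee_fin.
move=> y; rewrite /sublevel/= lee_fin => ya.
rewrite enormB [leRHS]enormB.
have [yq|/ltW qy] := leP (enorm (y - x)) (enorm (q - x)).
  by apply: pmin; rewrite inE.
exact: le_trans qy.
Qed.

(** Both parts reduce to [regular_steepest_descent] and
    [constant_steepest_descent]. In the first part the projection has positive
    limiting slope, hence is no local minimizer of [f] and lies at distance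
    [eps] from [x]; being the nearest point, it puts all minimizers on the
    sphere. In the second part either some minimizer on the ball is a global
    minimizer of [f], and [x] minimizes the regularization, or none is. *)
Theorem theorem4p5 (R : realType) (d : nat) (f : 'rV[R]_d -> R) (eps : R)
  (fqc : quasiconvex (EFin \o f))
  (flip : locally_lipschitz f)
  (eps_gt0 : 0 < eps) :
  ae_on (U_set eps (EFin \o f))
    (admits_steepest_descent (inf_reg eps (EFin \o f))) /\
  ((forall x, x \in edom (EFin \o f) `\` argmin (EFin \o f) ->
      exists delta l : R, [/\ 0 < delta, 0 < l &
        forall y, y \in eball x delta `&` edom (EFin \o f) ->
          (l%:E < slope (EFin \o f) y)%E]) ->
   ae_on (edom (inf_reg eps (EFin \o f)))
     (admits_steepest_descent (inf_reg eps (EFin \o f)))).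
Proof.
have f_cont := locally_lipschitz_continuous flip.
have f_qc x y (t : R) : 0 <= t <= 1 ->
    f (t *: x + (1 - t) *: y) <= Num.max (f x) (f y).
  by move=> /andP[t0 t1]; have := fqc x y t t0 t1; rewrite /= -EFin_max lee_fin.
have gE := inf_regE eps_gt0 f_cont.
split=> [|fslope]; apply: ae_on_everywhere => x.
  rewrite /U_set gE /= => /(limiting_slope_gt0 (@f_cont _))[rho rho0 rhoP].
  have := selectP eps_gt0 f_cont x; set q := select f eps x => xq.
  have := eproj_sublevel x f_cont (lexx (f q)).
  rewrite -[f q]/(regularization f eps x); set p := eproj _ _ in rhoP *.
  rewrite /is_proj /sublevel /= lee_fin => -[pq pmin].
  have xp : ball_argmin f eps x p.
    have [xqe _] := xq; apply: (ball_argmin_le xq _ pq).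
    by apply: le_trans xqe; apply: pmin; rewrite lee_fin.
  have pe : enorm (x - p) = eps.
    apply: argmin_interior_local_min xp _ => //; apply: rhoP.
    by rewrite subrr enorm0.
  have xs : sphere_argmin f eps x.
    move=> q' xq'; apply/eqP; rewrite eq_le xq'.1 /= -[leLHS]pe.
    by apply: pmin; rewrite lee_fin (ball_argmin_eq xq' xq).
  exact: regular_steepest_descent xp xs rho0 rhoP.
rewrite gE => _.
have [xmin|xnmin] := pselect (forall y, f (select f eps x) <= f y).
  by apply: constant_steepest_descent => y; exact: xmin.
have nmin q : ball_argmin f eps x q -> exists2 rho, 0 < rho &
    forall y, enorm (y - q) < rho -> not_local_min f y.
  move=> xq; have [|delta [l [delta0 l0 dl]]] := fslope q.
    rewrite inE; split; first exact: ltry.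
    move=> qmin; apply: xnmin => y.
    rewrite (ball_argmin_eq (selectP eps_gt0 f_cont x) xq) -lee_fin.
    exact: qmin.
  exists delta => // y yq; apply: slope_gt0_not_local_min.
  have : (l%:E < slope (EFin \o f) y)%E.
    by apply: dl; rewrite inE; split=> //; exact: ltry.
  by apply: lt_trans; rewrite lte_fin.
have xsel := selectP eps_gt0 f_cont x; have [rho rho0 rhoP] := nmin _ xsel.
apply: (regular_steepest_descent eps_gt0 flip f_qc xsel _ rho0 rhoP).
move=> q xq; have [r r0 rP] := nmin _ xq.
by apply: argmin_interior_local_min xq _; apply: rP; rewrite subrr enorm0.
Qed.
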